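(* Let $\rho:\pi(B)\to{\rm SL}(2,\mathbb{C})$ be an irreducible representation of the Borromean link group, with conjugacy class $[\rho]$ identified with its character. The twisted Alexander polynomial of the Borromean link associated to $\rho$ is given by $$\Delta^{[\rho]}_B\doteq \prod_{j=1}^3(s_j+s_j^{-1}-t_j)+\begin{cases} 0, & [\rho]\in\mathcal{X}^{+}_{1,i}\cup\mathcal{X}^{-}_{1,i}\ \text{or}\ [\rho]\in\mathcal{X}_{2,i}\ \text{for some } i,\\ 4t_{123}+t_1t_2t_3, &[\rho]\in\mathcal{X}_{3,i}\ \text{for some } i,\\ \theta^2t_1t_2t_3, &[\rho]\in\mathcal{X}_4,\end{cases}$$ where in the last case $\theta$ is the parameter of $[\rho]=(t_1,t_2,t_3,\theta)\in\mathcal{X}_4$.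
   Context: Notation: $[x,y]=xyx^{-1}y^{-1}$, $\overline{x}=x^{-1}$. $B\subset S^3$ is the Borromean link, with group $$\pi(B)=\pi_1(S^3\setminus B)\cong\langle x_1,x_2,x_3\mid r_1,r_2\rangle,\quad r_1=[x_2,[x_3,\overline{x_1}]],\ r_2=[x_3,[x_1,\overline{x_2}]],$$ where $x_j$ is a meridian of the $j$-th component. A representation is irreducible if the elements of its image have no common eigenvector. Twisted Alexander polynomial: let $\Phi:\mathbb{Z}[\pi(B)]\to\mathcal{M}_2(\mathbb{C}[s_1^{\pm1},s_2^{\pm1},s_3^{\pm1}])$ be the ring homomorphism with $\Phi(x_j)=s_j\rho(x_j)$ ($\mathcal{M}_n(R)$ denotes $n\times n$ matrices over $R$). Let $M$ be the $2\times 3$ matrix whose $(i,j)$-entry is the image in $\mathbb{Z}[\pi(B)]$ of the Fox derivative $\partial r_i/\partial x_j$, and $M_v$ the matrix obtained by deleting the $v$-th column. Then $$\Delta_B^{[\rho]}=\Delta_B^{\rho}\doteq\frac{\det\Phi(M_v)}{\det\Phi(1-x_v)},$$ where $\Phi(M_v)$ is the $4\times4$ matrix obtained by applying $\Phi$ to each entry, and $\doteq$ means equality up to multiplication by $s_1^{k_1}s_2^{k_2}s_3^{k_3}$ with $k_1,k_2,k_3\in\mathbb{Z}$. It is known that this does not depend on $v$ and depends only on the conjugacy class of $\rho$. (This presentation is strongly Tietze equivalent to a Wirtinger presentation, so it may be used for the definition.) Indices are modulo 3 in $\{1,2,3\}$. With $\mathbf{x}_i=\rho(x_i)$, put $t_i={\rm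 tr}(\mathbf{x}_i)$, $t_{ij}=t_{i,j}={\rm tr}(\mathbf{x}_i\mathbf{x}_j)$ ($i\ne j$), $t_{123}={\rm tr}(\mathbf{x}_1\mathbf{x}_2\mathbf{x}_3)$, $f_{i,j}=t_i^2+t_j^2+t_{ij}^2-t_it_jt_{ij}-2$. The irreducible character variety $\mathcal{X}^{\rm irr}(B)$ (the set of characters of irreducible representations of $\pi(B)$) is decomposed as the union, over $i\in\{1,2,3\}$ where applicable, of the following sets of characters, defined by conditions on the traces: - $\mathcal{X}^{+}_{1,i}$: $t_i=2$, $t_{i,i\pm1}=t_{i\pm1}$, $t_{123}=t_{i-1,i+1}$, $f_{i-1,i+1}\ne2$; - $\mathcal{X}^{-}_{1,i}$: $t_i=-2$, $t_{i,i\pm1}=-t_{i\pm1}$, $t_{123}=-t_{i-1,i+1}$, $f_{i-1,i+1}\ne2$; - $\mathcal{X}_{2,i}$: $t_i=t_{i,i\pm1}=t_{123}=0$, $f_{i-1,i+1}=2$, $t_{i\pm1}^2\ne4$; - $\mathcal{X}_{3,i}$: $t_{i\pm1}=t_{i-1,i+1}=0$, $t_it_{123}=t_{i,i-1}t_{i,i+1}$, $t_{i,i-1}^2+t_{i,i+1}^2+t_{123}^2=4-t_i^2\ne0$; - $\mathcal{X}_4$: there is $\theta$ with $(t_1,t_2,t_3,\theta)\in(\mathbb{C}^\ast)^4$, $\theta^4-(2-4\sum_{i=1}^3t_i^{-2})\theta^2+\prod_{i=1}^3(1-4t_i^{-2})=0$, $t_{ij}=\frac{\theta+1}{2}t_it_j$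 for $i<j$, and $t_{123}=(\frac{\theta+1}{2})^2t_1t_2t_3$. Here a condition containing $\pm1$ in a subscript is required for both signs. *)

(* Defs.v *)
From HB Require Import structures.
From mathcomp Require Import all_boot all_order all_algebra generic_quotient.
From mathcomp Require Import freeg mpoly.
From mathcomp Require Import complex.
From mathcomp Require Import boolp reals.

Set Implicit Arguments.
Unset Strict Implicit.
Unset Printing Implicit Defensive.

Import GRing.Theory.

Local Open Scope quotient_scope.
Local Open Scope ring_scope.

(* A word in n generators: the letter (j, true) stands for x_j and (j, false)
   for its inverse. *)
Definition word (n : nat) := seq ('I_n * bool).

Definition wgen n (j : 'I_n) : word n := [:: (j, true)].

Definition winv n (w : word n) : word n := rev [seq (l.1, ~~ l.2) | l <- w].

(* [u, v] = u v u^-1 v^-1; MathComp's [~ u, v] is u^-1 v^-1 u v instead. *)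
Definition wcomm n (u v : word n) : word n := u ++ v ++ winv u ++ winv v.

Inductive word_eq n (rels : seq (word n)) : word n -> word n -> Prop :=
| word_eq_refl u : word_eq rels u u
| word_eq_sym u v : word_eq rels u v -> word_eq rels v u
| word_eq_trans u v w :
    word_eq rels u v -> word_eq rels v w -> word_eq rels u w
| word_eq_cat u u' v v' :
    word_eq rels u u' -> word_eq rels v v' -> word_eq rels (u ++ v) (u' ++ v')
| word_eq_cancel (j : 'I_n) (b : bool) :
    word_eq rels [:: (j, b); (j, ~~ b)] [::]
| word_eq_rel r : r \in rels -> word_eq rels r [::].

Section PresentedGroup.
Variables (n : nat) (rels : seq (word n)).

Definition word_eqb (u v : word n) : bool := `[< word_eq rels u v >].

Lemma word_eqb_refl : reflexive word_eqb.
Proof. by move=> u; apply/asboolP; apply: word_eq_refl. Qed.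

Lemma word_eqb_sym : ssrbool.symmetric word_eqb.
Proof.
by move=> u v; apply/asboolP/asboolP; apply: word_eq_sym.
Qed.

Lemma word_eqb_trans : transitive word_eqb.
Proof.
move=> v u w /asboolP uv /asboolP vw.
by apply/asboolP; apply: word_eq_trans uv vw.
Qed.

Canonical word_equiv :=
  EquivRel word_eqb word_eqb_refl word_eqb_sym word_eqb_trans.
Canonical word_equiv_direct := defaultEncModRel word_eqb.

(* The group < x_j, j < n | rels >. *)
Definition presented : Type := {eq_quot word_eqb}.

HB.instance Definition _ := Choice.on presented.
HB.instance Definition _ := Quotient.on presented.
HB.instance Definition _ : EqQuotient _ word_eqb presented :=
  EqQuotient.on presented.

Definition pclass (w : word n) : presented := \pi_presented w.

Lemma pclassP (u v : word n) : word_eq rels u v <-> pclass u = pclass v.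
Proof.
split=> [uv|/eqmodP/asboolP//].
by apply/eqmodP; apply/asboolP.
Qed.

Lemma pclassK (g : presented) : pclass (repr g) = g.
Proof. exact: reprK. Qed.

Lemma repr_pclass (w : word n) : word_eq rels (repr (pclass w)) w.
Proof. by apply/pclassP; rewrite pclassK. Qed.

Definition pone : presented := pclass [::].
Definition pmul (g h : presented) : presented := pclass (repr g ++ repr h).
Definition pinv (g : presented) : presented := pclass (winv (repr g)).

Lemma pmulE (u v : word n) : pmul (pclass u) (pclass v) = pclass (u ++ v).
Proof. by apply/pclassP; apply: word_eq_cat; apply: repr_pclass. Qed.

Lemma winvV (w : word n) : word_eq rels (winv w ++ w) [::].
Proof.
elim: w => [|[j b] w IHw]; first exact: word_eq_refl.
rewrite /winv map_cons rev_cons -cats1 -catA /=.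
have e : word_eq rels [:: (j, ~~ b), (j, b) & w] w.
  rewrite -[(_, _) :: _]/([:: (j, ~~ b); (j, b)] ++ w) -{2}[w]cat0s.
  apply: word_eq_cat (word_eq_refl _ _).
  by rewrite -{2}[b]negbK; apply: word_eq_cancel.
by apply: word_eq_trans (word_eq_cat (word_eq_refl _ _) e) IHw.
Qed.

Lemma winvK : involutive (@winv n).
Proof.
move=> w; rewrite /winv map_rev revK -map_comp -[RHS]map_id.
by apply: eq_map => -[j b] /=; rewrite negbK.
Qed.

Lemma pmulA : associative pmul.
Proof.
move=> g h k; rewrite -[g]pclassK -[h]pclassK -[k]pclassK.
by rewrite !pmulE catA.
Qed.

Lemma pmul1 : left_id pone pmul.
Proof. by move=> g; rewrite -[g]pclassK pmulE cat0s. Qed.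

Lemma pmulr1 : right_id pone pmul.
Proof. by move=> g; rewrite -[g]pclassK pmulE cats0. Qed.

Lemma pmulV : left_inverse pone pinv pmul.
Proof.
move=> g; rewrite -{2}[g]pclassK pmulE.
by apply/pclassP; apply: winvV.
Qed.

Lemma pmulrV : right_inverse pone pinv pmul.
Proof.
move=> g; rewrite -{1}[g]pclassK pmulE; apply/pclassP.
by rewrite -{1}[repr g]winvK; apply: winvV.
Qed.

HB.instance Definition _ :=
  isGroup.Build presented pmulA pmul1 pmulr1 pmulV pmulrV.

Lemma pclass_cat (u v : word n) :
  pclass (u ++ v) = (pclass u * pclass v)%g.
Proof. by rewrite -pmulE. Qed.

Lemma pclass_inv (w : word n) : pclass (winv w) = ((pclass w)^-1)%g.
Proof.
have /(congr1 (fun g => (g * (pclass w)^-1)%g)) :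
  (pclass (winv w) * pclass w = 1)%g.
  by rewrite -pclass_cat; apply/pclassP; apply: winvV.
by rewrite mulgK mul1g.
Qed.

End PresentedGroup.

(* The integral group ring Z[G]: finite formal sums, with the bilinear extension
   of the group law as product. *)
Section GroupRing.
Variable G : groupType.

Definition group_ring : Type := {freeg G}.

HB.instance Definition _ := GRing.Zmodule.on group_ring.
HB.instance Definition _ := GRing.Lmodule.on group_ring.

Definition gr_of (g : G) : group_ring := << g >>.

Definition gr_mul (a b : group_ring) : group_ring :=
  fglift (fun g : G => fglift (fun h : G => gr_of (g * h)%g) b) a.

Lemma freeg_lift_zmod (V : lmodType int) (f : G -> V) :
  zmod_morphism (fglift f : group_ring -> V).
Proof. exact: lift_is_additive. Qed.

Lemma fglift_of (V : lmodType int) (f : G -> V) (g : G) :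
  fglift f (gr_of g) = f g.
Proof. by rewrite /gr_of liftU scale1r. Qed.

Lemma group_ring_ind (P : group_ring -> Prop) :
    (forall g, P (gr_of g)) -> (forall a b, P a -> P b -> P (a - b)) ->
  forall a, P a.
Proof.
move=> Pof PB.
have P0 : P 0 by rewrite -(subrr (gr_of 1%g)); apply: PB.
have PD a b : P a -> P b -> P (a + b).
  by move=> Pa Pb; rewrite -[b]opprK -[- b]sub0r; do 2!apply: (PB) => //.
elim/freeg_ind_dom0 => [//|k g a _ _ Pa]; apply: (PD) => //.
have -> : << k *g g >> = gr_of g *~ k.
  by rewrite /gr_of freeg_mulz intz.
have Pn m : P (gr_of g *+ m).
  by elim: m => [|m IHm]; rewrite ?mulr0n // mulrS; apply: (PD).
by case: k => m; rewrite ?NegzE ?mulrNz -?pmulrn // -sub0r; apply: PB.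
Qed.

Lemma gr_mulBl (a b c : group_ring) :
  gr_mul (a - b) c = gr_mul a c - gr_mul b c.
Proof. exact: freeg_lift_zmod. Qed.

Lemma gr_mul_of (g : G) (b : group_ring) :
  gr_mul (gr_of g) b = fglift (fun h : G => gr_of (g * h)%g) b.
Proof. by rewrite /gr_mul fglift_of. Qed.

Lemma gr_mulBr (c a b : group_ring) :
  gr_mul c (a - b) = gr_mul c a - gr_mul c b.
Proof.
elim/group_ring_ind: c => [g|c d IHc IHd].
  by rewrite !gr_mul_of; apply: freeg_lift_zmod.
rewrite !gr_mulBl IHc IHd !opprB addrACA [RHS]addrACA.
by congr (_ + _); apply: addrC.
Qed.

Lemma gr_mul_of2 (g h : G) : gr_mul (gr_of g) (gr_of h) = gr_of (g * h)%g.
Proof. by rewrite gr_mul_of fglift_of. Qed.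

Lemma gr_mulA : associative gr_mul.
Proof.
move=> a b c; elim/group_ring_ind: a => [g|a a' IHa IHa']; last first.
  by rewrite !gr_mulBl IHa IHa'.
elim/group_ring_ind: b => [h|b b' IHb IHb']; last first.
  by rewrite !(gr_mulBl, gr_mulBr) IHb IHb'.
elim/group_ring_ind: c => [k|c c' IHc IHc']; last first.
  by rewrite !gr_mulBr IHc IHc'.
by rewrite !gr_mul_of2 mulgA.
Qed.

Lemma gr_mul1 : left_id (gr_of 1%g) gr_mul.
Proof.
elim/group_ring_ind => [g|a b IHa IHb]; first by rewrite gr_mul_of2 mul1g.
by rewrite gr_mulBr IHa IHb.
Qed.

Lemma gr_mulr1 : right_id (gr_of 1%g) gr_mul.
Proof.
elim/group_ring_ind => [g|a b IHa IHb]; first by rewrite gr_mul_of2 mulg1.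
by rewrite gr_mulBl IHa IHb.
Qed.

Lemma gr_mulDl : left_distributive gr_mul +%R.
Proof.
move=> a b c; have mul0 : gr_mul 0 c = 0 by rewrite -{1}(subrr a) gr_mulBl subrr.
have mulN : gr_mul (- b) c = - gr_mul b c.
  by rewrite -[- b]sub0r gr_mulBl mul0 sub0r.
by rewrite -{1}[b]opprK gr_mulBl mulN opprK.
Qed.

Lemma gr_mulDr : right_distributive gr_mul +%R.
Proof.
move=> c a b; have mul0 : gr_mul c 0 = 0 by rewrite -{1}(subrr a) gr_mulBr subrr.
have mulN : gr_mul c (- b) = - gr_mul c b.
  by rewrite -[- b]sub0r gr_mulBr mul0 sub0r.
by rewrite -{1}[b]opprK gr_mulBr mulN opprK.
Qed.

Lemma gr_1_neq0 : gr_of 1%g != 0.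
Proof. by rewrite /gr_of freegU_eq0. Qed.

HB.instance Definition _ := GRing.Zmodule_isNzRing.Build group_ring
  gr_mulA gr_mul1 gr_mulr1 gr_mulDl gr_mulDr gr_1_neq0.

Lemma gr_ofM (g h : G) : gr_of (g * h)%g = gr_of g * gr_of h.
Proof. by rewrite -gr_mul_of2. Qed.

Lemma gr_of1 : gr_of 1%g = 1.
Proof. by []. Qed.

End GroupRing.

(* The image in Z[< x | rels >] of the Fox derivative of w with respect to x_j,
   by recursion on the word w: x_k contributes delta_jk, its inverse contributes
   - delta_jk x_j^-1, and d(l w) = d l + l (d w). *)
Fixpoint fox n (rels : seq (word n)) (j : 'I_n) (w : word n) :
    group_ring (presented rels) :=
  if w is l :: w' then
    (if l.1 == j then
       (if l.2 then 1 else - gr_of (pclass rels [:: (j, false)]))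
     else 0)
    + gr_of (pclass rels [:: l]) * fox rels j w'
  else 0.

Lemma fox_cat n (rels : seq (word n)) (j : 'I_n) (u v : word n) :
  fox rels j (u ++ v) = fox rels j u + gr_of (pclass rels u) * fox rels j v.
Proof.
elim: u => [|l u IHu] /=; first by rewrite add0r gr_of1 mul1r.
by rewrite IHu mulrDr addrA mulrA -gr_ofM -pclass_cat.
Qed.

(* Indices 1, 2, 3 of the components are 0, 1, 2 : 'I_3, with the arithmetic
   of Z/3. *)
Definition borromean_relators : seq (word 3) :=
  let x1 := wgen (0 : 'I_3) in
  let x2 := wgen (1 : 'I_3) in
  let x3 := wgen (2%:R : 'I_3) in
  [:: wcomm x2 (wcomm x3 (winv x1)); wcomm x3 (wcomm x1 (winv x2))].

Definition borromean_group : groupType := presented borromean_relators.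

Definition meridian (j : 'I_3) : borromean_group :=
  pclass borromean_relators (wgen j).

Definition fox_matrix : 'M[group_ring borromean_group]_(2, 3) :=
  \matrix_(i, j)
     fox borromean_relators j (nth [::] borromean_relators i).

Section Representations.
Variable C : fieldType.

(* A homomorphism G -> SL(2, C). *)
Definition SL2_representation (G : groupType) (rho : G -> 'M[C]_2) : Prop :=
  [/\ rho 1%g = 1%:M,
      forall g h, rho (g * h)%g = rho g *m rho h
    & forall g, \det (rho g) = 1].

Definition irreducible_rep (G : groupType) (rho : G -> 'M[C]_2) : Prop :=
  ~ exists2 v : 'cV[C]_2,
      v != 0 & forall g, exists a : C, rho g *m v = a *: v.

Section Characters.
Variable rho : borromean_group -> 'M[C]_2.

Definition tr1 (i : 'I_3) : C := \tr (rho (meridian i)).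

Definition tr2 (i j : 'I_3) : C :=
  \tr (rho (meridian i) *m rho (meridian j)).

Definition tr123 : C :=
  \tr (rho (meridian 0) *m rho (meridian 1) *m rho (meridian 2%:R)).

Definition f_ (i j : 'I_3) : C :=
  tr1 i ^+ 2 + tr1 j ^+ 2 + tr2 i j ^+ 2 - tr1 i * tr1 j * tr2 i j - 2%:R.

Definition X1plus (i : 'I_3) : Prop :=
  [/\ tr1 i = 2%:R,
      tr2 i (i + 1) = tr1 (i + 1) /\ tr2 i (i - 1) = tr1 (i - 1),
      tr123 = tr2 (i - 1) (i + 1)
    & f_ (i - 1) (i + 1) != 2%:R].

Definition X1minus (i : 'I_3) : Prop :=
  [/\ tr1 i = - 2%:R,
      tr2 i (i + 1) = - tr1 (i + 1) /\ tr2 i (i - 1) = - tr1 (i - 1),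
      tr123 = - tr2 (i - 1) (i + 1)
    & f_ (i - 1) (i + 1) != 2%:R].

Definition X2 (i : 'I_3) : Prop :=
  [/\ tr1 i = 0,
      tr2 i (i + 1) = 0 /\ tr2 i (i - 1) = 0,
      tr123 = 0,
      f_ (i - 1) (i + 1) = 2%:R
    & tr1 (i + 1) ^+ 2 != 4%:R /\ tr1 (i - 1) ^+ 2 != 4%:R].

Definition X3 (i : 'I_3) : Prop :=
  [/\ tr1 (i + 1) = 0 /\ tr1 (i - 1) = 0,
      tr2 (i - 1) (i + 1) = 0,
      tr1 i * tr123 = tr2 i (i - 1) * tr2 i (i + 1),
      tr2 i (i - 1) ^+ 2 + tr2 i (i + 1) ^+ 2 + tr123 ^+ 2 = 4%:R - tr1 i ^+ 2
    & 4%:R - tr1 i ^+ 2 != 0].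

(* X4 theta: the character lies in X_4, with parameter theta. *)
Definition X4 (theta : C) : Prop :=
  [/\ (forall i, tr1 i != 0) /\ theta != 0,
      theta ^+ 4 - (2%:R - 4%:R * \sum_(i < 3) tr1 i ^- 2) * theta ^+ 2
        + \prod_(i < 3) (1 - 4%:R * tr1 i ^- 2) = 0,
      forall i j : 'I_3, (i < j)%N ->
        tr2 i j = (theta + 1) / 2%:R * tr1 i * tr1 j
    & tr123 = ((theta + 1) / 2%:R) ^+ 2 * \prod_(i < 3) tr1 i].

End Characters.

(* The field C(s_1, s_2, s_3), which contains the Laurent polynomial ring
   C[s_1^+-1, s_2^+-1, s_3^+-1]; the quotient defining the twisted Alexander
   polynomial is formed in it. *)
Definition ratfun : fieldType := {fraction {mpoly C[3]}}.

Definition svar (j : 'I_3) : ratfun := tofrac ('X_j : {mpoly C[3]}).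

Definition scst (c : C) : ratfun := tofrac (c%:MP : {mpoly C[3]}).

HB.instance Definition _ :=
  GRing.RMorphism.copy scst (@tofrac {mpoly C[3]} \o @mpolyC 3 C).

(* Equality up to multiplication by s_1^k_1 s_2^k_2 s_3^k_3. *)
Definition doteq (p q : ratfun) : Prop :=
  exists k : 'I_3 -> int, p = \prod_(j < 3) svar j ^ k j * q.

(* Phi is the ring homomorphism with Phi x_j = s_j rho(x_j); its values have
   Laurent polynomial entries, since every element of the group is a product of
   the x_j and their inverses. *)
Definition twists (rho : borromean_group -> 'M[C]_2)
    (Phi : {rmorphism group_ring borromean_group -> 'M[ratfun]_2}) : Prop :=
  forall j : 'I_3,
    Phi (gr_of (meridian j)) = svar j *: map_mx scst (rho (meridian j)).

Definition sword (w : word 3) : ratfun :=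
  \prod_(l <- w) (if l.2 then svar l.1 else (svar l.1)^-1).

Lemma svar_neq0 (j : 'I_3) : svar j != 0.
Proof. by rewrite /svar tofrac_eq0 -msupp_eq0 msuppX. Qed.

Lemma sword_cat (u w : word 3) : sword (u ++ w) = sword u * sword w.
Proof. exact: big_cat. Qed.

Lemma sword_neq0 (w : word 3) : sword w != 0.
Proof.
rewrite /sword; elim: w => [|[j b] w IHw]; first by rewrite big_nil oner_eq0.
by rewrite big_cons mulf_neq0 //; case: b; rewrite /= ?invr_eq0 svar_neq0.
Qed.

Lemma sword_inv (w : word 3) : sword (winv w) = (sword w)^-1.
Proof.
elim: w => [|[j b] w IHw]; first by rewrite /sword !big_nil invr1.
rewrite /winv map_cons rev_cons -cats1 sword_cat IHw /sword big_seq1 big_cons.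
by rewrite invfM mulrC; case: b; rewrite /= ?invrK.
Qed.

Lemma sword_comm (u w : word 3) : sword (wcomm u w) = 1.
Proof.
rewrite /wcomm !sword_cat !sword_inv mulrA mulrACA mulfV ?sword_neq0 // mul1r.
by rewrite mulfV ?sword_neq0.
Qed.

Lemma sword_eq (u w : word 3) :
  word_eq borromean_relators u w -> sword u = sword w.
Proof.
elim=> {u w} [//|//|u v w _ -> _ -> //|u u' v v' _ e _ e'|j b|r].
- by rewrite !sword_cat e e'.
- rewrite /sword big_cons big_seq1 big_nil.
  by case: b => /=; rewrite ?mulfV ?mulVf ?svar_neq0.
by rewrite !inE => /orP[] /eqP ->; rewrite sword_comm /sword big_nil.
Qed.

Lemma twists_exists (rho : borromean_group -> 'M[C]_2) :
    SL2_representation rho ->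
  exists Phi : {rmorphism group_ring borromean_group -> 'M[ratfun]_2},
    twists rho Phi.
Proof.
case=> rho1 rhoM _.
pose phi (g : borromean_group) : 'M[ratfun]_2 :=
  sword (repr g) *: map_mx scst (rho g).
have phi1 : phi 1%g = 1.
  rewrite /phi (sword_eq (repr_pclass _ [::])) /sword big_nil scale1r rho1.
  exact: map_mx1.
have phiM g h : phi (g * h)%g = phi g * phi h.
  rewrite /phi (sword_eq (repr_pclass _ _)) sword_cat rhoM map_mxM /=.
  by rewrite -[_ * _ in RHS]scalemxAl -scalemxAr scalerA.
pose Phi (a : group_ring borromean_group) : 'M[ratfun]_2 :=
  fglift (phi : borromean_group -> zmodule 'M[ratfun]_2) a.
have PhiB : zmod_morphism Phi 
  by exact: (@freeg_lift_zmod _ (zmodule 'M[ratfun]_2) phi).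
have Phi_of g : Phi (gr_of g) = phi g 
  by exact: (@fglift_of _ (zmodule 'M[ratfun]_2) phi).
have PhiM : monoid_morphism Phi.
  split=> [|a b]; first by rewrite -gr_of1 Phi_of.
  elim/group_ring_ind: a => [g|a a' IHa IHa']; last first.
    by rewrite mulrBl !PhiB IHa IHa' mulrBl.
  elim/group_ring_ind: b => [h|b b' IHb IHb']; last first.
    by rewrite mulrBr !PhiB IHb IHb' mulrBr.
  by rewrite -gr_ofM !Phi_of phiM.
pose PhiZ := GRing.isZmodMorphism.Build _ _ Phi PhiB.
pose PhiR := GRing.isMonoidMorphism.Build _ _ Phi PhiM.
pose PhiE : {rmorphism group_ring borromean_group -> 'M[ratfun]_2} :=
  HB.pack Phi PhiZ PhiR.
exists PhiE => j; rewrite [LHS]Phi_of /phi; congr (_ *: _).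
by rewrite (sword_eq (repr_pclass _ _)) /sword big_seq1.
Qed.

Definition Phi_mx (Phi : group_ring borromean_group -> 'M[ratfun]_2)
    (A : 'M[group_ring borromean_group]_(2, 2)) : 'M[ratfun]_(2 + 2) :=
  block_mx (Phi (A 0 0)) (Phi (A 0 1)) (Phi (A 1 0)) (Phi (A 1 1)).

Definition twisted_alexander
    (Phi : group_ring borromean_group -> 'M[ratfun]_2) (v : 'I_3) : ratfun :=
  \det (Phi_mx Phi (col' v fox_matrix)) / \det (Phi (1 - gr_of (meridian v))).

End Representations.

(* Main.v *)
Require Import Defs.
From HB Require Import structures.
From mathcomp Require Import all_boot all_order all_algebra.
From mathcomp Require Import freeg mpoly complex boolp reals.
From mathcomp Require Import ring.

Import GRing.Theory.
Local Open Scope ring_scope.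

(** A single formula covers all the cases:
    [[
      Delta = s1^-1 s2^-1 s3 * (prod_j (s_j + s_j^-1 - t_j) + kappa),
      kappa = (4 - t1^2) t123 + t1 t12 t13 - 2 t2 t13 - 2 t3 t12 + t1 t2 t3.
    ]]
    The cases of the theorem are then substitutions into [kappa]: it vanishes
    on X_1 and X_2, equals [4 t123 + t1 t2 t3] on X_3, and on X_4, with
    [a = (theta + 1) / 2], it is
    [t1 t2 t3 ((4 - t1^2) a^2 + t1^2 a^2 - 4 a + 1)], that is,
    [t1 t2 t3 (2 a - 1)^2 = theta^2 t1 t2 t3].

    To obtain the formula, delete the second column.  Put
    [y = x1 x2^-1 x1^-1] and [d = [x1, x2^-1] = y x2].  Since a relator is a
    commutator of elements that commute in the group, its Fox derivatives are
    short ([fox_wcomm_commute]): the first row of the remaining matrix is left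
    divisible by [x2 - 1], which is exactly the denominator.  What is left is,
    up to invertible factors, the 4 x 4 determinant of the blocks
    [[
       1 - x3               x1 - 1
       (x3 - 1)(1 - y)x3    (1 - d)x3 .
    ]]
    For 2 x 2 blocks such a determinant is
    [|A||D| + |B||C| - tr (A^* B D^* C)], where the star is the adjugate
    ([det_block2]).  The product [|B||C|] gives the product of the three
    characteristic polynomials.  In the trace, [d] commutes with [x3] by the
    second relation; this cancels [|A||D|] and leaves a polynomial in [s3] all
    of whose coefficients but one vanish, by conjugation invariance of the trace
    and, for one of them, by the first relation ([tr_block]).  The surviving
    coefficient is a combination of four traces, which Cayley-Hamilton turns
    into [kappa] ([kappa_homogeneous]).

    Deleting another column changes nothing, because the fundamental formula of
    the Fox calculus makes the three block columns linearly dependent with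
    coefficients [x_j - 1] ([fox_fundamental], [det_block_col12],
    [det_block_col23]). *)

Set Implicit Arguments.
Unset Strict Implicit.

(** * Two by two matrices *)

Lemma ord2_ind (P : 'I_2 -> Prop) : P 0 -> P 1 -> forall i, P i.
Proof.
move=> P0 P1 [[|[|//]] lti].
  by rewrite (_ : Ordinal lti = 0) //; apply: val_inj.
by rewrite (_ : Ordinal lti = 1) //; apply: val_inj.
Qed.

Lemma sum2 (V : nmodType) (F : 'I_2 -> V) : \sum_(i < 2) F i = F 0 + F 1.
Proof. by rewrite big_ord_recl big_ord1; congr (_ + F _); apply: val_inj. Qed.

Lemma tr2E (K : pzRingType) (A : 'M[K]_2) : \tr A = A 0 0 + A 1 1.
Proof. exact: sum2. Qed.

Lemma det2E (K : comNzRingType) (A : 'M[K]_2) :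
  \det A = A 0 0 * A 1 1 - A 0 1 * A 1 0.
Proof.
rewrite (expand_det_row A 0) sum2 /cofactor !det_mx11 !mxE /= mul1r expr1.
rewrite mulN1r mulrN; congr (A _ _ * A _ _ - A _ _ * A _ _); exact: val_inj.
Qed.

Lemma adj2E (K : comNzRingType) (A : 'M[K]_2) : \adj A = (\tr A)%:M - A.
Proof.
apply/matrixP=> i j; rewrite !mxE /cofactor det_mx11 tr2E !mxE.
elim/ord2_ind: i; elim/ord2_ind: j => /=.
all: rewrite ?mulr1n ?mulr0n ?sub0r ?addrK ?[A 0 0 + _]addrC
  ?addrK.
all: rewrite ?expr1 ?mul1r ?mulN1r ?sqrrN ?expr1n ?mul1r.
all: try congr (- _).
all: congr (A _ _); exact: val_inj.
Qed.

Lemma adj2_sub1 (K : comNzRingType) (A : 'M[K]_2) : \adj (1 - A) = 1 - \adj A.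
Proof.
rewrite !adj2E; apply/matrixP => i j.
by elim/ord2_ind: i; elim/ord2_ind: j; rewrite !(tr2E, mxE) /=; ring.
Qed.

Lemma adj2M (K : comNzRingType) (A B : 'M[K]_2) :
  \adj (A * B) = \adj B * \adj A.
Proof.
rewrite !adj2E -!mulmxE; apply/matrixP => i j.
by elim/ord2_ind: i; elim/ord2_ind: j; rewrite !(tr2E, mxE, sum2) /=; ring.
Qed.

Lemma det_sub2 (K : comNzRingType) (A B : 'M[K]_2) :
  \det (A - B) = \det A + \det B - \tr (\adj A * B).
Proof.
rewrite adj2E -!mulmxE !(det2E, tr2E, mxE) !sum2 !mxE /=; ring.
Qed.

Lemma det2_sub1 (K : comNzRingType) (A : 'M[K]_2) :
  \det (1 - A) = 1 - \tr A + \det A.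
Proof.
rewrite det_sub2 adj2E mxtrace1 det1.
have -> : (2%:R%:M - 1%:M : 'M[K]_2) = 1 by rewrite raddfMn /= mulr2n addrK.
by rewrite mul1r addrAC.
Qed.

Lemma det2_subC (K : comNzRingType) (A B : 'M[K]_2) :
  \det (A - B) = \det (B - A).
Proof. by rewrite -opprB -scaleN1r detZ sqrrN expr1n mul1r. Qed.

(** The Schur complement formula, with [det_sub2] expanding the determinant of
    the complement; the inverse of [A] then only enters through its adjugate. *)
Lemma det_block2 (K : fieldType) (A B C D : 'M[K]_2) : A \is a GRing.unit ->
  \det (block_mx A B C D : 'M_(2 + 2)) =
  \det A * \det D + \det B * \det C - \tr (\adj A * B * \adj D * C).
Proof.
move=> uA; have dA : \det A != 0 by move: uA; rewrite unitmxE unitfE.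
pose Z := C * A^-1 * B.
have -> : block_mx A B C D =
    block_mx 1%:M 0 (C * A^-1) 1%:M *m block_mx A B 0 (D - Z).
  by rewrite mulmx_block !mul1mx !mul0mx !addr0 mulmxE divrK // addrC subrK.
rewrite det_mulmx det_lblock !det1 !mul1r det_ublock det_sub2.
rewrite mulrBr mulrDr; congr (_ + _ - _).
  by rewrite /Z -!mulmxE !det_mulmx [\det A^-1]det_inv; field.
rewrite -mxtraceZ.
have -> : \det A *: (\adj D * Z) = \adj D * C * (\adj A * B).
  have -> : \adj A = \det A *: A^-1.
    by rewrite -[LHS]mulr1 -(divrr uA) mulrA -mulmxE mul_adj_mx mul_scalar_mx.
  by rewrite /Z -scalerAl -!scalerAr !mulrA.
by rewrite -!mulmxE mxtrace_mulC !mulmxA.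
Qed.

(** If the three block columns satisfy a linear relation with coefficients
    [u], [w], [z], column [B] times [w] is column [A] times [- u] up to a
    multiple of column [C].  No sign appears, as the blocks have even size. *)
Lemma det_block_col12 (K : comNzRingType) (A B C A' B' C' u w z : 'M[K]_2) :
  A * u + B * w + C * z = 0 -> A' * u + B' * w + C' * z = 0 ->
  \det (block_mx A C A' C' : 'M_(2 + 2)) * \det u =
  \det (block_mx B C B' C' : 'M_(2 + 2)) * \det w.
Proof.
move=> e e'.
have -> : \det u = \det (block_mx u 0 0 1%:M : 'M_(2 + 2)).
  by rewrite det_ublock det1 mulr1.
have -> : \det w = \det (block_mx (- w) 0 (- z) 1%:M : 'M_(2 + 2)).
  by rewrite det_lblock det1 mulr1 -[- w]sub0r det2_subC subr0.
rewrite -!det_mulmx !mulmx_block !(mulmx0, mulmx1, addr0, add0r) !mulmxE !mulrN.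
by congr (\det (block_mx _ _ _ _)); apply/eqP;
  rewrite -subr_eq0 opprD !opprK addrA ?e ?e'.
Qed.

Lemma det_block_col23 (K : comNzRingType) (A B C A' B' C' u w z : 'M[K]_2) :
  A * u + B * w + C * z = 0 -> A' * u + B' * w + C' * z = 0 ->
  \det (block_mx A B A' B' : 'M_(2 + 2)) * \det w =
  \det (block_mx A C A' C' : 'M_(2 + 2)) * \det z.
Proof.
move=> e e'.
have -> : \det w = \det (block_mx 1%:M 0 0 w : 'M_(2 + 2)).
  by rewrite det_ublock det1 mul1r.
have -> : \det z = \det (block_mx 1%:M (- u) 0 (- z) : 'M_(2 + 2)).
  by rewrite det_ublock det1 mul1r -[- z]sub0r det2_subC subr0.
rewrite -!det_mulmx !mulmx_block !(mulmx0, mulmx1, addr0, add0r) !mulmxE !mulrN.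
by congr (\det (block_mx _ _ _ _)); apply/eqP;
  rewrite -subr_eq0 opprD !opprK addrCA addrA ?e ?e'.
Qed.

Definition kappa_of (K : pzRingType) (t1 t2 t3 t12 t13 t123 : K) : K :=
  (4%:R - t1 ^+ 2) * t123 + t1 * t12 * t13 - 2%:R * (t2 * t13 + t3 * t12)
  + t1 * t2 * t3.

(** The powers of [\det X1] make both sides homogeneous in each matrix, so that
    the identity holds for all matrices; it is used for determinant 1, where
    [\adj] is the inverse and the right hand side is [kappa_of]. *)
Lemma kappa_homogeneous (K : comNzRingType) (X1 X2 X3 : 'M[K]_2) :
  let d1 := \det X1 in
  let T := \tr (X1 * X2 * X3) in
  \tr (X3 * X1 * X1 * \adj X2 * \adj X1) - d1 * \tr (X3 * X1 * \adj X2)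
  + \tr (X1 * \adj X3 * X1 * \adj X2 * \adj X1)
  - d1 * \tr (X1 * \adj X3 * \adj X2)
  = (4%:R * d1 - \tr X1 ^+ 2) * T + \tr X1 * \tr (X1 * X2) * \tr (X1 * X3)
    - 2%:R * d1 * (\tr X2 * \tr (X1 * X3) + \tr X3 * \tr (X1 * X2))
    + d1 * \tr X1 * \tr X2 * \tr X3.
Proof.
move=> d1 T; rewrite /d1 /T !adj2E -!mulmxE !(det2E, tr2E).
do 6!rewrite ?mxE ?sum2 -?[(0 : 'I_2) == 1]/false -?[(1 : 'I_2) == 0]/false
  ?eqxx ?mulr1n ?mulr0n.
ring.
Qed.

(** * Fox calculus *)

Section FoxCalculus.
Context (n : nat) (rels : seq (word n)).
Implicit Types (j : 'I_n) (u w : word n).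
Local Notation "[ 'e' w ]" := (gr_of (pclass rels w)) (format "[ 'e'  w ]").

Lemma fox_gen j k : fox rels j (wgen k) = (k == j)%:R.
Proof. by rewrite /= mulr0 addr0; case: eqP. Qed.

Lemma fox_inv j u : fox rels j (winv u) = - ([e winv u] * fox rels j u).
Proof.
elim: u => [|l u IHu]; first by rewrite /= mulr0 oppr0.
have -> : winv (l :: u) = winv u ++ winv [:: l].
  by rewrite /winv map_cons rev_cons -cats1.
rewrite fox_cat IHu (fox_cat _ _ [:: l] u).
rewrite pclass_cat gr_ofM [in RHS]mulrDr opprD addrC.
congr (_ + _); last first.
  rewrite mulrA -(mulrA _ [e winv _]) -gr_ofM -pclass_cat.
  have -> : pclass rels (winv [:: l] ++ [:: l]) = 1%g.
    by apply/pclassP; apply: winvV.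
  by rewrite gr_of1 mulr1.
rewrite -mulrA -mulrN; congr (_ * _).
case: l => k [] /=; rewrite /winv /= !mulr0 !addr0; case: eqP => [->|_];
  rewrite ?mulr0 ?mulr1 ?oppr0 //.
rewrite mulrN opprK -gr_ofM -pclass_cat.
rewrite (_ : pclass rels _ = 1%g) ?gr_of1 //; apply/pclassP.
exact: (word_eq_cancel _ _ true).
Qed.

Lemma fox_wcomm j u w :
  let g := pclass rels u in let h := pclass rels w in
  fox rels j (wcomm u w) =
    (1 - gr_of (g * h * g^-1)%g) * fox rels j u
    + gr_of g * (1 - gr_of (h * g^-1 * h^-1)%g) * fox rels j w.
Proof.
move=> g h; rewrite /wcomm !fox_cat !fox_inv !pclass_inv -/g -/h.
rewrite !mulrDr !mulrN !mulr1 !mulrA -!gr_ofM !mulgA.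
rewrite !mulrBl mul1r -!addrA; congr (_ + _); exact: addrCA.
Qed.

(** The conjugates in [fox_wcomm] collapse when the commutator is trivial. *)
Lemma fox_wcomm_commute j u w :
    (pclass rels u * pclass rels w = pclass rels w * pclass rels u)%g ->
  fox rels j (wcomm u w) =
    (1 - [e w]) * fox rels j u + ([e u] - 1) * fox rels j w.
Proof.
move=> uw; rewrite fox_wcomm mulrBr mulr1 -gr_ofM !mulgA uw.
by rewrite !mulgK mulgV gr_of1.
Qed.

Lemma wcomm_rel u w : wcomm u w \in rels ->
  (pclass rels u * pclass rels w = pclass rels w * pclass rels u)%g.
Proof.
move/word_eq_rel/pclassP; rewrite /wcomm !pclass_cat !pclass_inv => e1.
apply: (mulIg (pclass rels u)^-1%g); apply: (mulIg (pclass rels w)^-1%g).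
by rewrite -!mulgA e1 mulVKg mulgV.
Qed.

(** The derivatives telescope along the word. *)
Lemma fox_fundamental w :
  \sum_(j < n) fox rels j w * ([e wgen j] - 1) = [e w] - 1.
Proof.
elim: w => [|l w IHw] /=.
  by rewrite gr_of1 subrr big1 // => j _; rewrite mul0r.
under eq_bigr do rewrite mulrDl -mulrA.
rewrite big_split -mulr_sumr IHw /= -[l :: w]/([:: l] ++ w) pclass_cat gr_ofM.
rewrite (bigD1 l.1) //= eqxx big1 ?addr0; last first.
  by move=> j; rewrite eq_sym => /negbTE->; rewrite mul0r.
suff -> : (if l.2 then 1 else - [e [:: (l.1, false)]]) * ([e wgen l.1] - 1)
   = [e [:: l]] - 1 by rewrite mulrBr mulr1 addrC addrA addrNK.
case: l => k [] /=; rewrite ?mul1r // mulrBr mulr1 mulNr opprK.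
rewrite -gr_ofM -pclass_cat (_ : pclass rels _ = 1%g) ?gr_of1 1?addrC //.
by apply/pclassP; apply: (word_eq_cancel _ _ false).
Qed.

End FoxCalculus.

(** * The block determinant *)

Lemma mul_sub1_expand (S : pzRingType) (a x b e y : S) :
  a * (x - 1) * b * e * (1 - y) =
  a * x * b * e - a * 1 * b * e + a * b * (e * y) - a * x * b * (e * y).
Proof.
rewrite mulrBr mulr1 mulrBr !mulrBl !mulr1 !mulrA opprB addrA.
by rewrite -!addrA; congr (_ + (_ + _)); rewrite addrC.
Qed.

Lemma mul_sub_expand (S : pzRingType) (a b w x y : S) :
  (a - x) * y * (1 - b) * w =
  a * y * w - a * y * b * w - x * y * w + x * y * b * w.
Proof.
rewrite !mulrBr !mulr1 !mulrBl opprB !addrA addrAC.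
by congr (_ + _); exact: addrAC.
Qed.

Section BlockDet.
Context (K : fieldType) (G : groupType) (E : G -> 'M[K]_2).
Hypothesis E1 : E 1%g = 1.
Hypothesis EM : forall g h, E (g * h)%g = E g * E h.

Lemma EVl g : E g^-1%g * E g = 1. Proof. by rewrite -EM mulVg. Qed.
Lemma EVr g : E g * E g^-1%g = 1. Proof. by rewrite -EM mulgV. Qed.

Lemma tr_EC g h : \tr (E (g * h)%g) = \tr (E (h * g)%g).
Proof. by rewrite !EM -!mulmxE mxtrace_mulC. Qed.

Lemma tr_EJ g h : \tr (E (g * h * g^-1)%g) = \tr (E h).
Proof. by rewrite tr_EC mulgA mulVg mul1g. Qed.

Lemma det_E_neq0 g : \det (E g) != 0.
Proof.
have := congr1 determinant (EVr g).
rewrite det1 -mulmxE det_mulmx => /eqP; apply: contraTneq => ->.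
by rewrite mul0r eq_sym oner_eq0.
Qed.

Lemma det_EV g : \det (E g^-1%g) = (\det (E g))^-1.
Proof.
apply: (mulIf (det_E_neq0 g)); rewrite mulVf ?det_E_neq0 //.
by rewrite -det_mulmx mulmxE EVl det1.
Qed.

Lemma adj_E g : \adj (E g) = \det (E g) *: E g^-1%g.
Proof.
have := congr1 (fun A => A *m E g^-1%g) (mul_adj_mx (E g)).
by rewrite -mulmxA !mulmxE EVr mulr1 -mulmxE mul_scalar_mx.
Qed.

Lemma commE g h : (g * h = h * g)%g -> E g * E h = E h * E g.
Proof. by rewrite -!EM => ->. Qed.

Context (x1 x2 x3 : G).
Let c := (x3 * x1^-1 * x3^-1 * x1)%g.
Let y := (x1 * x2^-1 * x1^-1)%g.
Let d := (y * x2)%g.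
Hypothesis x2c : (x2 * c = c * x2)%g.
Hypothesis x3d : (x3 * d = d * x3)%g.
Hypothesis nz : \det (1 - E x3) != 0.

(** The part of the determinant beyond the product of the characteristic
    polynomials; for weights [s_j] it is [s1 s3 / s2 * kappa]
    ([four_tracesE]). *)
Definition four_traces : K :=
  \tr (E (x3 * x1 * y)%g) - \tr (E (x3 * x1 * x2^-1)%g)
  + \det (E x3) * (\tr (E (x1 * x3^-1 * y)%g) - \tr (E (x1 * x3^-1 * x2^-1)%g)).

Lemma det_Ed : \det (E d) = 1.
Proof.
rewrite /d /y !EM -!mulmxE !det_mulmx !det_EV.
by field; rewrite !det_E_neq0.
Qed.

(** After a cyclic rotation the trace is [q * \tr (a (x1 - 1) b e (1 - y))] with
    [a], [b], [e] as below.  They commute pairwise, by the second relation for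
    [e], and [a b] is the scalar [- p].  Expand the two binomials and use
    [e y = y - x2^-1].  In the terms without [x1], [a b] comes out as a scalar;
    in those without [y], [e] moves past [b] and a rotation brings [b] next to
    [a].  What remains of them are differences of traces of conjugate elements,
    which vanish, and [p * \tr e = p * \det (1 - d)].  The term with both [x1]
    and [y] gives [four_traces]. *)
Lemma tr_block :
  \tr (\adj (1 - E x3) * (E x1 - 1) * \adj ((1 - E d) * E x3)
       * ((E x3 - 1) * (1 - E y) * E x3))
  = \det (E x3) * (\det (1 - E x3) * \det (1 - E d) - four_traces).
Proof.
pose q := \det (E x3); pose p := \det (1 - E x3).
pose a := E x3 - q%:M; pose b := 1 - E x3^-1%g; pose e := 1 - E d^-1%g.
have x3vd : (x3 * d^-1 = d^-1 * x3)%g.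
  by apply: (mulgI d); rewrite !mulgA -x3d mulgK mulgV mul1g.
have x3vdv : (x3^-1 * d^-1 = d^-1 * x3^-1)%g.
  by rewrite -!invgM x3d.
(* By Cayley-Hamilton, q E(x3)^-1 = tr E(x3) - E(x3). *)
have ba : b * a = (- p)%:M.
  rewrite /b /a /p det2_sub1 -/q.
  have qE : (\tr (E x3))%:M - E x3 = q *: E x3^-1%g by rewrite -adj_E adj2E.
  have vq : E x3^-1%g * q%:M = (\tr (E x3))%:M - E x3.
    by rewrite -mulmxE mul_mx_scalar.
  rewrite mulrBl mul1r mulrBr EVl vq.
  apply/matrixP=> i j.
  by elim/ord2_ind: i; elim/ord2_ind: j; rewrite !mxE /=; ring.
have be : b * e = e * b.
  apply: commrB (commr1 _) _; apply/commr_sym/commrB; first exact: commr1.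
  exact: (commE (esym x3vdv)).
have ea : e * (E x3 - 1) = (E x3 - 1) * e.
  apply: commrB _ (commr1 _); apply/commr_sym/commrB; first exact: commr1.
  exact: (commE x3vd).
have -> : \adj (1 - E x3) = 1 - q *: E x3^-1%g by rewrite adj2_sub1 adj_E.
have -> : \adj ((1 - E d) * E x3) = q *: E x3^-1%g * e.
  by rewrite adj2M adj2_sub1 !adj_E det_Ed scale1r.
have aE : E x3 * (1 - q *: E x3^-1%g) = a.
  by rewrite mulrBr mulr1 -scalerAr EVr scalemx1.
have bE : E x3^-1%g * (E x3 - 1) = b by rewrite mulrBr EVl mulr1.
have -> : \tr ((1 - q *: E x3^-1%g) * (E x1 - 1) * (q *: E x3^-1%g * e)
     * ((E x3 - 1) * (1 - E y) * E x3)) =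
   q * \tr (a * (E x1 - 1) * b * e * (1 - E y)).
  rewrite [in LHS]mulrA -mulmxE mxtrace_mulC !mulmxE !mulrA aE -scalerAr.
  rewrite -!scalerAl mxtraceZ -[in LHS](mulrA _ e) ea.
  by rewrite -bE !mulrA.
congr (_ * _).
have tra f : \tr (a * f * b * e) = - p * \tr (f * e).
  rewrite -!mulrA be -mulmxE mxtrace_mulC !mulmxE -!mulrA ba.
  by rewrite -!mulmxE mul_mx_scalar -scalemxAr mxtraceZ.
have eyE : e * E y = E y - E x2^-1%g.
  by rewrite /e mulrBl mul1r -EM /d invgM mulgVK.
have abE : a * b = (- p)%:M.
  rewrite -ba; apply: commrB (commr1 _) _; apply/commr_sym/commrB.
    by rewrite /GRing.comm EVl EVr.
  exact: scalar_mxC.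
have -> : \tr (a * (E x1 - 1) * b * e * (1 - E y)) =
  \tr (a * E x1 * b * e) - \tr (a * 1 * b * e) + \tr (a * b * (e * E y))
  - \tr (a * E x1 * b * (e * E y)) by rewrite mul_sub1_expand !(raddfD, raddfN).
rewrite !tra eyE abE.
have -> : \tr (E x1 * e) = 0.
  rewrite /e mulrBr mulr1 -EM raddfB /= tr_EC.
  have -> : (d^-1 * x1 = x2^-1 * x1 * x2^-1^-1)%g.
    by rewrite /d /y !invgM !invgK !mulgA mulgVK.
  by rewrite tr_EJ subrr.
have -> : \tr ((- p)%:M * (E y - E x2^-1%g)) = 0.
  by rewrite -mulmxE mul_scalar_mx mxtraceZ raddfB /= /y tr_EJ subrr mulr0.
have -> : \tr (1 * e) = \det (1 - E d).
  rewrite mul1r det2_sub1 det_Ed /e raddfB /= mxtrace1.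
  have -> : E d^-1%g = \adj (E d) by rewrite adj_E det_Ed scale1r.
  by rewrite adj2E raddfB /= mxtrace_scalar; ring.
have -> : \tr (a * E x1 * b * (E y - E x2^-1%g)) = four_traces.
  pose w := E y - E x2^-1%g.
  have trw g : \tr (E g * w) = \tr (E (g * y)%g) - \tr (E (g * x2^-1)%g).
    by rewrite /w mulrBr raddfB /= !EM.
  have -> : a * E x1 * b * w = E (x3 * x1)%g * w - E (x3 * x1 * x3^-1)%g * w
      - q *: (E x1 * w) + q *: (E (x1 * x3^-1)%g * w).
    by rewrite mul_sub_expand -!mulmxE !mul_scalar_mx !mulmxE -!scalerAl !EM.
  have x1w : \tr (E x1 * w) = 0.
    by rewrite trw /y !mulgA -(mulgA x1) tr_EJ subrr.
  (* The first relation: x3 x1 x3^-1 = x1 c^-1, and c commutes with x2. *)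
  have x3w : \tr (E (x3 * x1 * x3^-1)%g * w) = 0.
    have x2cv : (c^-1 * x2^-1 = x2^-1 * c^-1)%g by rewrite -!invgM x2c.
    have -> : (x3 * x1 * x3^-1 = x1 * c^-1)%g.
      by rewrite /c !invgM !invgK !mulgA mulgV mul1g.
    rewrite trw.
    have -> : (x1 * c^-1 * y = x1 * (c^-1 * (x1 * x2^-1)) * x1^-1)%g.
      by rewrite /y !mulgA.
    by rewrite tr_EJ -(mulgA x1) x2cv (mulgA x1) (tr_EC _ c^-1%g) subrr.
  clearbody w; rewrite !(raddfD, raddfN) /= !mxtraceZ x1w x3w !trw.
  by rewrite /four_traces -/q mulr0 !subr0.
by rewrite -/p mulr0 addr0 sub0r mulNr opprK.
Qed.

(** The blocks are those of the Fox matrix without its second column, with the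
    left factor [x2 - 1] of the first row removed. *)
Lemma block_formula :
  \det (E x1) *
  \det (block_mx (E (x3 * x1^-1)%g * (E x3^-1%g - 1))
                 (1 - E (x3 * x1^-1 * x3^-1)%g)
                 ((E x3 - 1) * (1 - E y)) (1 - E d) : 'M_(2 + 2))
  = \det (1 - E x1) * \det (1 - E x2) * \det (1 - E x3) / \det (E x2)
    + four_traces.
Proof.
set N := block_mx _ _ _ _.
have q0 := det_E_neq0 x3.
(* Clears the factors around 1 - x1^-1, so that the diagonal blocks become
   1 - x3 and (1 - d) x3, which commute. *)
have e0 : block_mx (E (x1 * x3^-1)%g) 0 0 1%:M *m N *m
     block_mx (E x3) 0 0 (E x3) =
   block_mx (1 - E x3) (E x1 - 1)
            ((E x3 - 1) * (1 - E y) * E x3) ((1 - E d) * E x3).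
  rewrite !mulmx_block !(mul0mx, mulmx0, mul1mx, addr0, add0r) !mulmxE.
  congr block_mx.
  - by rewrite mulrA -EM mulgA mulgVK mulgV E1 mul1r mulrBl EVl mul1r.
  - by rewrite mulrBr mulr1 mulrBl -!EM !mulgA !mulgVK mulgV E1.
have u : 1 - E x3 \is a GRing.unit by rewrite unitmxE unitfE.
have := congr1 determinant e0; rewrite det_block2 // tr_block.
rewrite !det_mulmx !det_ublock det1 mulr1.
rewrite (_ : 1 - E y = E x1 * (1 - E x2^-1%g) * E x1^-1%g); last first.
  by rewrite mulrBr mulr1 mulrBl EVr -!EM.
rewrite (_ : 1 - E x2^-1%g = (E x2 - 1) * E x2^-1%g); last first.
  by rewrite mulrBl EVr mul1r.
rewrite EM -!mulmxE !det_mulmx !det_EV !(det2_subC _ 1).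
have q1 := det_E_neq0 x1; have q2 := det_E_neq0 x2.
move/(congr1 (fun z => z / \det (E x3))); rewrite -!mulrA => e1.
move: four_traces (\det N) e1 => k m e1.
apply: etrans (etrans e1 _); first by field.
by field; rewrite q1 q2 q0.
Qed.

End BlockDet.

(** * Representations with weights *)

Section Weighted.
Context (K : fieldType) (G : groupType) (E : G -> 'M[K]_2).
Hypothesis E1 : E 1%g = 1.
Hypothesis EM : forall g h, E (g * h)%g = E g * E h.

Lemma weighted_det (x : G) (s : K) (X : 'M[K]_2) :
  E x = s *: X -> \det X = 1 -> \det (E x) = s ^+ 2.
Proof. by move=> -> dX; rewrite detZ dX mulr1. Qed.

Lemma weighted_inv (x : G) (s : K) (X : 'M[K]_2) :
  E x = s *: X -> \det X = 1 -> s != 0 -> E x^-1%g = s^-1 *: \adj X.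
Proof.
move=> Ex dX s0; have := adj_E E1 EM x.
rewrite (weighted_det Ex dX) Ex adj2E mxtraceZ -scale_scalar_mx -scalerBr.
rewrite -adj2E => e1; apply: (scalerI (expf_neq0 2 s0)).
by rewrite -e1 scalerA expr2 mulfK.
Qed.

Lemma weighted_det1 (x : G) (s : K) (X : 'M[K]_2) :
  E x = s *: X -> \det X = 1 -> s != 0 ->
  \det (1 - E x) = s * (s + s^-1 - \tr X).
Proof.
move=> Ex dX s0; rewrite det2_sub1 (weighted_det Ex dX) Ex mxtraceZ.
by field.
Qed.

Context (x1 x2 x3 : G) (s1 s2 s3 : K) (X1 X2 X3 : 'M[K]_2).
Hypotheses (Ex1 : E x1 = s1 *: X1) (Ex2 : E x2 = s2 *: X2).
Hypotheses (Ex3 : E x3 = s3 *: X3).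
Hypotheses (dX1 : \det X1 = 1) (dX2 : \det X2 = 1) (dX3 : \det X3 = 1).
Hypotheses (s1_neq0 : s1 != 0) (s2_neq0 : s2 != 0) (s3_neq0 : s3 != 0).

Let k := kappa_of (\tr X1) (\tr X2) (\tr X3) (\tr (X1 * X2)) (\tr (X1 * X3))
  (\tr (X1 * X2 * X3)).

Lemma four_tracesE : four_traces E x1 x2 x3 = s1 * s3 / s2 * k.
Proof.
have := kappa_homogeneous X1 X2 X3.
rewrite /= dX1 !mul1r !mulr1 -/(kappa_of _ _ _ _ _ _) => e1.
rewrite /k /four_traces (weighted_det Ex3 dX3) !mulgA !EM.
rewrite !(weighted_inv Ex1, weighted_inv Ex2, weighted_inv Ex3) //.
rewrite Ex1 Ex3 -!(scalerAl, scalerAr) !mxtraceZ -e1.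
by field; rewrite s1_neq0 s2_neq0 s3_neq0.
Qed.

Hypothesis x2c :
  (x2 * (x3 * x1^-1 * x3^-1 * x1) = (x3 * x1^-1 * x3^-1 * x1) * x2)%g.
Hypothesis x3d :
  (x3 * (x1 * x2^-1 * x1^-1 * x2) = (x1 * x2^-1 * x1^-1 * x2) * x3)%g.
Hypothesis nz : \det (1 - E x3) != 0.

Lemma weighted_block :
  \det (block_mx (E (x3 * x1^-1)%g * (E x3^-1%g - 1))
                 (1 - E (x3 * x1^-1 * x3^-1)%g)
                 ((E x3 - 1) * (1 - E (x1 * x2^-1 * x1^-1)%g))
                 (1 - E (x1 * x2^-1 * x1^-1 * x2)%g) : 'M_(2 + 2))
  = s1^-1 * s2^-1 * s3 *
   ((s1 + s1^-1 - \tr X1) * (s2 + s2^-1 - \tr X2) * (s3 + s3^-1 - \tr X3) + k).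
Proof.
have := block_formula E1 EM x2c x3d nz.
rewrite four_tracesE (weighted_det Ex1 dX1) (weighted_det Ex2 dX2).
rewrite (weighted_det1 Ex1) ?(weighted_det1 Ex2) ?(weighted_det1 Ex3) //.
move=> e1; apply: (mulfI (expf_neq0 2 s1_neq0)); rewrite {}e1.
by field; rewrite s1_neq0 s2_neq0 s3_neq0.
Qed.

End Weighted.

(** * The Fox matrix of the Borromean link *)

Lemma sum3 (V : nmodType) (F : 'I_3 -> V) :
  \sum_(j < 3) F j = F 0 + F 1 + F 2%:R.
Proof.
rewrite !big_ord_recl big_ord0 addr0 addrA.
by congr (_ + F _ + F _); apply: val_inj.
Qed.

Lemma prod3 (K : comPzRingType) (F : 'I_3 -> K) :
  \prod_(j < 3) F j = F 0 * F 1 * F 2%:R.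
Proof.
rewrite !big_ord_recl big_ord0 mulr1 mulrA.
by congr (_ * F _ * F _); apply: val_inj.
Qed.

Lemma ord3_ind (P : 'I_3 -> Prop) : P 0 -> P 1 -> P 2%:R -> forall i, P i.
Proof.
move=> P0 P1 P2 [[|[|[|//]]] lti].
- by rewrite (_ : Ordinal lti = 0) //; apply: val_inj.
- by rewrite (_ : Ordinal lti = 1) //; apply: val_inj.
- by rewrite (_ : Ordinal lti = 2%:R) //; apply: val_inj.
Qed.

Lemma ord3E : ((0 + 1 : 'I_3) = 1) * ((0 - 1 : 'I_3) = 2%:R) *
  ((1 + 1 : 'I_3) = 2%:R) * ((1 - 1 : 'I_3) = 0) *
  ((2%:R + 1 : 'I_3) = 0) * ((2%:R - 1 : 'I_3) = 1).
Proof. by do !split; apply: val_inj. Qed.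

Local Notation m1 := (meridian 0).
Local Notation m2 := (meridian 1).
Local Notation m3 := (meridian 2%:R).
Local Notation e := (@gr_of borromean_group).
Local Notation M := fox_matrix.

Lemma meridian_rel1 :
  (m2 * (m3 * m1^-1 * m3^-1 * m1) = (m3 * m1^-1 * m3^-1 * m1) * m2)%g.
Proof.
have := @wcomm_rel 3 borromean_relators (wgen 1)
  (wcomm (wgen 2%:R) (winv (wgen 0))) (mem_head _ _).
by rewrite /wcomm !pclass_cat !pclass_inv !invgK !mulgA.
Qed.

Lemma meridian_rel2 :
  (m3 * (m1 * m2^-1 * m1^-1 * m2) = (m1 * m2^-1 * m1^-1 * m2) * m3)%g.
Proof.
have := @wcomm_rel 3 borromean_relators (wgen 2%:R)
  (wcomm (wgen 0) (winv (wgen 1))) (mem_last _ [:: _]).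
by rewrite /wcomm !pclass_cat !pclass_inv !invgK !mulgA.
Qed.

Lemma fox_matrix0 j :
  M 0 j = (1 - e (m3 * m1^-1 * m3^-1 * m1)%g) * (1 == j)%:R
    + (e m2 - 1) * ((1 - e (m3 * m1^-1 * m3^-1)%g) * (2%:R == j)%:R
      + e (m3 * m1^-1)%g * (e m3^-1%g - 1) * (0 == j)%:R).
Proof.
rewrite mxE -[nth _ _ _]/(wcomm (wgen 1) (wcomm (wgen 2%:R) (winv (wgen 0))))
  fox_wcomm_commute; last first.
  by apply: wcomm_rel; apply: mem_head.
rewrite fox_wcomm fox_inv !fox_gen /wcomm !pclass_cat !pclass_inv !invgK !mulgA.
congr (_ + _ * (_ + _)).
rewrite -/(meridian _) mulrN mulrA -mulNr; congr (_ * _).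
by rewrite !mulrBr !mulrBl !mulr1 -!gr_ofM !mulgA mulgK opprB.
Qed.

Lemma fox_matrix1 j :
  M 1 j = (1 - e (m1 * m2^-1 * m1^-1 * m2)%g) * (2%:R == j)%:R
    + (e m3 - 1) * ((1 - e (m1 * m2^-1 * m1^-1)%g) * (0 == j)%:R
      + e (m1 * m2^-1)%g * (e m1^-1%g - 1) * (1 == j)%:R).
Proof.
rewrite mxE -[nth _ _ _]/(wcomm (wgen 2%:R) (wcomm (wgen 0) (winv (wgen 1))))
  fox_wcomm_commute; last first.
  by apply: wcomm_rel; exact: (mem_last _ [:: _]).
rewrite fox_wcomm fox_inv !fox_gen /wcomm !pclass_cat !pclass_inv !invgK !mulgA.
congr (_ + _ * (_ + _)).
rewrite -/(meridian _) mulrN mulrA -mulNr; congr (_ * _).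
by rewrite !mulrBr !mulrBl !mulr1 -!gr_ofM !mulgA mulgK opprB.
Qed.

Lemma fox_matrix_fundamental i :
  M i 0 * (e m1 - 1) + M i 1 * (e m2 - 1) + M i 2%:R * (e m3 - 1) = 0.
Proof.
have := @fox_fundamental 3 borromean_relators (nth [::] borromean_relators i).
rewrite sum3 !mxE => ->.
have -> : pclass borromean_relators (nth [::] borromean_relators i) = 1%g.
  by apply/pclassP; apply: word_eq_rel; apply: mem_nth; case: i.
by rewrite gr_of1 subrr.
Qed.

(** * The twisted Alexander polynomial *)

Section CharacterConstant.
Context (C : fieldType) (rho : borromean_group -> 'M[C]_2).

Definition kappa : C :=
  kappa_of (tr1 rho 0) (tr1 rho 1) (tr1 rho 2%:R)
    (tr2 rho 0 1) (tr2 rho 0 2%:R) (tr123 rho).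

Lemma tr2C i j : tr2 rho i j = tr2 rho j i.
Proof. exact: mxtrace_mulC. Qed.

Lemma kappa_X1plus i : X1plus rho i -> kappa = 0.
Proof.
rewrite /X1plus /kappa /kappa_of; elim/ord3_ind: i; rewrite !ord3E.
- by case=> -> [-> ->] -> _; ring.
- by case=> -> [_ /[!(tr2C 1)] ->] -> _; ring.
- by case=> -> [/[!(tr2C 2%:R)] -> _] -> _; rewrite (tr2C 1); ring.
Qed.

Lemma kappa_X1minus i : X1minus rho i -> kappa = 0.
Proof.
rewrite /X1minus /kappa /kappa_of; elim/ord3_ind: i; rewrite !ord3E.
- by case=> -> [-> ->] -> _; ring.
- by case=> -> [_ /[!(tr2C 1)] ->] -> _; ring.
- by case=> -> [/[!(tr2C 2%:R)] -> _] -> _; rewrite (tr2C 1); ring.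
Qed.

Lemma kappa_X2 i : X2 rho i -> kappa = 0.
Proof.
rewrite /X2 /kappa /kappa_of; elim/ord3_ind: i; rewrite !ord3E.
- by case=> -> [-> ->] -> _ _; ring.
- by case=> -> [_ /[!(tr2C 1)] ->] -> _ _; ring.
- by case=> -> [/[!(tr2C 2%:R)] -> _] -> _ _; ring.
Qed.

Lemma kappa_X3 i :
  X3 rho i -> kappa = 4%:R * tr123 rho + \prod_(j < 3) tr1 rho j.
Proof.
rewrite prod3 /X3 /kappa /kappa_of; elim/ord3_ind: i; rewrite !ord3E.
- case=> [[-> ->] _ e1 _ _]; move: e1.
  by set a := tr2 _ _ _; set b := tr2 _ _ _ => e1; ring: e1.
- by case=> [[-> ->] -> _ _ _]; ring.
- by case=> [[-> ->] /[!(tr2C 1)] -> _ _ _]; ring.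
Qed.

Lemma kappa_X4 theta : 2%:R != 0 :> C ->
  X4 rho theta -> kappa = theta ^+ 2 * \prod_(j < 3) tr1 rho j.
Proof.
move=> two_neq0 [_ _ tr2E tr3E].
rewrite /kappa /kappa_of tr3E !tr2E // prod3.
by field.
Qed.

End CharacterConstant.

Section Twisted.
Context (C : fieldType) (rho : borromean_group -> 'M[C]_2).
Context (Phi : {rmorphism group_ring borromean_group -> 'M[ratfun C]_2}).
Hypothesis Phi_rho : twists rho Phi.
Hypothesis det_rho : forall g, \det (rho g) = 1.

Let s (j : 'I_3) := svar C j.
Let X (j : 'I_3) : 'M[ratfun C]_2 := map_mx (@scst C) (rho (meridian j)).
Let E g := Phi (e g).

Lemma detX j : \det (X j) = 1.
Proof. by rewrite det_map_mx det_rho rmorph1. Qed.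

Lemma trX j : \tr (X j) = scst (tr1 rho j).
Proof. by rewrite trace_map_mx. Qed.

Lemma E_gen j : E (meridian j) = s j *: X j.
Proof. exact: Phi_rho. Qed.

Lemma E_1 : E 1%g = 1. Proof. by rewrite /E gr_of1 rmorph1. Qed.
Lemma E_M g h : E (g * h)%g = E g * E h.
Proof. by rewrite /E gr_ofM rmorphM. Qed.

(** The constant term in [s_j] is 1, as evaluation at 0 shows. *)
Lemma det1_E_neq0 j : \det (1 - E (meridian j)) != 0.
Proof.
rewrite det2_sub1 (weighted_det (E_gen j) (detX j)) E_gen mxtraceZ trX.
have -> : 1 - s j * scst (tr1 rho j) + s j ^+ 2
  = tofrac (1 - 'X_j * (tr1 rho j)%:MP + 'X_j ^+ 2 : {mpoly C[3]}).
  by rewrite rmorphD rmorphB rmorph1 rmorphM rmorphXn.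
rewrite tofrac_eq0; apply/eqP => /(congr1 (meval (fun _ => 0))).
rewrite rmorphD rmorphB rmorph1 rmorphM rmorphXn /= mevalXU mul0r expr0n.
rewrite subr0 addr0.
by rewrite meval0; apply/eqP/oner_neq0.
Qed.

Lemma Phi_mx_col' (v j k : 'I_3) :
  fintype.lift v 0 = j -> fintype.lift v 1 = k ->
  Phi_mx Phi (col' v M) =
    block_mx (Phi (M 0 j)) (Phi (M 0 k)) (Phi (M 1 j)) (Phi (M 1 k)).
Proof. by move=> <- <-; rewrite /Phi_mx !mxE. Qed.

Lemma Phi_fundamental i : Phi (M i 0) * (E m1 - 1) + Phi (M i 1) * (E m2 - 1)
  + Phi (M i 2%:R) * (E m3 - 1) = 0.
Proof.
have := congr1 Phi (fox_matrix_fundamental i).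
by rewrite !rmorphD !rmorphM !rmorphB !rmorph1 rmorph0.
Qed.

Lemma twisted_alexanderE v : twisted_alexander Phi v = twisted_alexander Phi 1.
Proof.
rewrite /twisted_alexander !rmorphB !rmorph1 -!/(E _).
have l1 : fintype.lift (1 : 'I_3) 0 = 0 by apply: val_inj.
have l2 : fintype.lift (1 : 'I_3) 1 = 2%:R by apply: val_inj.
rewrite (Phi_mx_col' l1 l2); elim/ord3_ind: v.
- have k1 : fintype.lift (0 : 'I_3) 0 = 1 by apply: val_inj.
  have k2 : fintype.lift (0 : 'I_3) 1 = 2%:R by apply: val_inj.
  rewrite (Phi_mx_col' k1 k2).
  have := det_block_col12 (Phi_fundamental 0) (Phi_fundamental 1).
  rewrite !(det2_subC _ 1) => e1.
  by apply/eqP; rewrite eqr_div ?det1_E_neq0 // e1.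
- by rewrite (Phi_mx_col' l1 l2).
have k1 : fintype.lift (2%:R : 'I_3) 0 = 0 by apply: val_inj.
have k2 : fintype.lift (2%:R : 'I_3) 1 = 1 by apply: val_inj.
rewrite (Phi_mx_col' k1 k2).
have := det_block_col23 (Phi_fundamental 0) (Phi_fundamental 1).
rewrite !(det2_subC _ 1) => e1.
by apply/eqP; rewrite eqr_div ?det1_E_neq0 // e1.
Qed.

Lemma twisted_alexander1 : twisted_alexander Phi 1 =
   (s 0)^-1 * (s 1)^-1 * s 2%:R *
   (\prod_(j < 3) (s j + (s j)^-1 - scst (tr1 rho j)) + scst (kappa rho)).
Proof.
have tX2 i j : \tr (X i * X j) = scst (tr2 rho i j).
  by rewrite -mulmxE -map_mxM trace_map_mx.
have tX3 : \tr (X 0 * X 1 * X 2%:R) = scst (tr123 rho).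
  by rewrite -!mulmxE -!map_mxM trace_map_mx.
have := weighted_block E_1 E_M (E_gen 0) (E_gen 1) (E_gen 2%:R)
  (detX _) (detX _) (detX _) (svar_neq0 _ _) (svar_neq0 _ _) (svar_neq0 _ _)
  meridian_rel1 meridian_rel2 (det1_E_neq0 _).
rewrite prod3 !trX !tX2 tX3.
have -> : scst (kappa rho) = kappa_of (scst (tr1 rho 0)) (scst (tr1 rho 1))
  (scst (tr1 rho 2%:R)) (scst (tr2 rho 0 1)) (scst (tr2 rho 0 2%:R))
    (scst (tr123 rho)).
  by rewrite /kappa /kappa_of
    !(rmorphD, rmorphN, rmorphM, rmorphXn, rmorph_nat).
move=> <-; rewrite /twisted_alexander rmorphB rmorph1 -/(E _).
have l1 : fintype.lift (1 : 'I_3) 0 = 0 by apply: val_inj.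
have l2 : fintype.lift (1 : 'I_3) 1 = 2%:R by apply: val_inj.
rewrite (Phi_mx_col' l1 l2) !fox_matrix0 !fox_matrix1 /=.
rewrite !(mulr0, mulr1, add0r, addr0).
rewrite !(rmorphM, rmorphB, rmorph1) -!/(E _).
set A := _ * (E m3^-1%g - 1); set B := 1 - E (m3 * m1^-1 * m3^-1)%g.
rewrite (_ : block_mx _ _ _ _ = block_mx (E m2 - 1) 0 0 1%:M *m
  block_mx A B ((E m3 - 1) * (1 - E (m1 * m2^-1 * m1^-1)%g))
           (1 - E (m1 * m2^-1 * m1^-1 * m2)%g)); last first.
  by rewrite mulmx_block !(mul0mx, mul1mx, addr0, add0r).
rewrite det_mulmx det_ublock det1 mulr1 mulrC (det2_subC (E m2)).
by rewrite mulKf ?det1_E_neq0.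
Qed.

Lemma twisted_alexander_formula v : twisted_alexander Phi v =
   (s 0)^-1 * (s 1)^-1 * s 2%:R *
   (\prod_(j < 3) (s j + (s j)^-1 - scst (tr1 rho j)) + scst (kappa rho)).
Proof. by rewrite twisted_alexanderE twisted_alexander1. Qed.

Lemma doteq_formula v : doteq (twisted_alexander Phi v)
   (\prod_(j < 3) (s j + (s j)^-1 - scst (tr1 rho j)) + scst (kappa rho)).
Proof.
exists (fun j : 'I_3 => if j == 2%:R then 1 else -1).
by rewrite twisted_alexander_formula; congr (_ * _); rewrite prod3.
Qed.

End Twisted.

Unset Implicit Arguments.

Theorem theorem4p1 (R : realType)
    (rho : borromean_group -> 'M[R[i]]_2)
    (rho_rep : SL2_representation rho)
    (rho_irr : irreducible_rep rho)
    (Phi : {rmorphism group_ring borromean_group -> 'M[ratfun R[i]]_2})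
    (Phi_rho : twists rho Phi)
    (v : 'I_3) :
  let P := \prod_(j < 3) (svar R[i] j + (svar R[i] j)^-1 - scst (tr1 rho j)) in
  [/\ (exists i, X1plus rho i \/ X1minus rho i) \/ (exists i, X2 rho i) ->
        doteq (twisted_alexander Phi v) (P + 0),
      (exists i, X3 rho i) ->
        doteq (twisted_alexander Phi v)
          (P + scst (4%:R * tr123 rho + \prod_(j < 3) tr1 rho j))
    & forall theta : R[i], X4 rho theta ->
        doteq (twisted_alexander Phi v)
          (P + scst (theta ^+ 2 * \prod_(j < 3) tr1 rho j))].
Proof.
move=> P; have [_ _ det_rho] := rho_rep.
have formula := doteq_formula Phi_rho det_rho v.
split=> [cases|[i Xi]|theta Xtheta].
- suff <- : scst (kappa rho) = 0 by [].
  rewrite -[RHS](rmorph0 (@scst _)); congr scst.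
  by case: cases => [[i [/kappa_X1plus|/kappa_X1minus]]|[i /kappa_X2]].
- by rewrite -(kappa_X3 Xi).
- by rewrite -(kappa_X4 _ Xtheta) // Num.Theory.pnatr_eq0.
Qed.
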